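(* Let $v$ be any vertex of $G$ (defined in the context), with base point $p$. Then the three pairs of $v$ can be written (choosing which element of each unordered pair is called $q_i$ and which $r_i$) as $v=(p,q_ar_a,q_br_b,q_cr_c)$ in such a way that the 4 copies of $K_4$ in $G$ containing $v$ are exactly $\langle q_aq_bq_c\rangle$, $\langle q_ar_br_c\rangle$, $\langle r_aq_br_c\rangle$, $\langle r_ar_bq_c\rangle$; moreover the 3 copies of $K_{2,2,2}$ in $G$ containing $v$ are exactly $[pq_ar_a]_a$, $[pq_br_b]_b$, $[pq_cr_c]_c$.
   Context: The Fano plane $\mathcal F$ has points $1,\dots,7$ and lines $\{1,2,3\},\{1,4,5\},\{1,6,7\},\{2,4,6\},\{2,5,7\},\{3,4,7\},\{3,5,6\}$. For a point $p$, the three lines through $p$ are $\{p,q,r\}$ for three disjoint pairs $\{q,r\}$ partitioning $\mathcal F\setminus\{p\}$. An ordered pencil through $p$ is a tuple $v=(p,q_ar_a,q_br_b,q_cr_c)$ in which $q_ar_a,q_br_b,q_cr_c$ are these three (unordered) pairs listed in a chosen linear order (positions $a<b<c$). The graph $G$ has the 42 ordered pencils as vertices, with $v=(p,q_ar_a,q_br_b,q_cr_c)$ and $v'=(p',q'_ar'_a,q'_br'_b,q'_cr'_c)$ adjacent iff $p\neq p'$ and $|\{q_i,r_i\}\cap\{q'_i,r'_i\}|=1$ for each $i\in\{a,b,c\}$. A copy of $H$ in $G$ is an induced subgraph isomorphic to $H$. For an ordered Fano line $xyz$ (a line $\{x,y,z\}$ of $\mathcal F$ with its points in a chosen order), $\langle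 xyz\rangle$ denotes the subgraph of $G$ induced by the 4 vertices $(p,q_ar_a,q_br_b,q_cr_c)$ with $p\notin\{x,y,z\}$, $x\in\{q_a,r_a\}$, $y\in\{q_b,r_b\}$, $z\in\{q_c,r_c\}$ (one for each such $p$); it is a copy of $K_4$. For a (unordered) Fano line $xyz$ and position $j\in\{a,b,c\}$, $[xyz]_j$ denotes the subgraph of $G$ induced by the 6 ordered pencils whose base point lies in $\{x,y,z\}$ and whose $j$-th line is $\{x,y,z\}$; it is a copy of $K_{2,2,2}$. *)

(* Defs.v *)
From HB Require Import structures.
From mathcomp Require Import all_boot.

Set Implicit Arguments.
Unset Strict Implicit.
Unset Printing Implicit Defensive.

Record sgraph := SGraph {
  vertex :> finType;
  edge : rel vertex;
  edge_sym : symmetric edge;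
  edge_irrefl : irreflexive edge }.

Definition isomorphic (F G : sgraph) : Prop :=
  exists f : F -> G, bijective f /\ forall x y, edge (f x) (f y) = edge x y.

Section Induced.
Variables (G : sgraph) (S : {set G}).

Definition induced_edge : rel {x : G | x \in S} :=
  [rel x y | edge (val x) (val y)].

Lemma induced_edge_sym : symmetric induced_edge.
Proof. by move=> x y; apply: edge_sym. Qed.

Lemma induced_edge_irrefl : irreflexive induced_edge.
Proof. by move=> x; apply: edge_irrefl. Qed.

Definition induced : sgraph := SGraph induced_edge_sym induced_edge_irrefl.
End Induced.

(* An induced subgraph is determined by its vertex set, so copies are
   represented by, and compared as, sets of vertices. *)
Definition is_copy (H G : sgraph) (S : {set G}) : Prop :=
  isomorphic (induced S) H.

Definition K4_edge : rel 'I_4 := [rel x y | x != y].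

Lemma K4_edge_sym : symmetric K4_edge.
Proof. by move=> x y; rewrite /K4_edge /= eq_sym. Qed.

Lemma K4_edge_irrefl : irreflexive K4_edge.
Proof. by move=> x; rewrite /K4_edge /= eqxx. Qed.

Definition K4 : sgraph := SGraph K4_edge_sym K4_edge_irrefl.

(* The first component of a vertex names its part. *)
Definition K222_edge : rel ('I_3 * 'I_2)%type := [rel x y | x.1 != y.1].

Lemma K222_edge_sym : symmetric K222_edge.
Proof. by move=> x y; rewrite /K222_edge /= eq_sym. Qed.

Lemma K222_edge_irrefl : irreflexive K222_edge.
Proof. by move=> x; rewrite /K222_edge /= eqxx. Qed.

Definition K222 : sgraph := SGraph K222_edge_sym K222_edge_irrefl.

(* The element of value i stands for the Fano point labelled i.+1. *)
Definition point : finType := 'I_7.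

Definition labelled (i j k : nat) : {set point} :=
  [set x : point | x.+1 \in [:: i; j; k]].

Definition fano_lines : seq {set point} :=
  [:: labelled 1 2 3; labelled 1 4 5; labelled 1 6 7; labelled 2 4 6;
      labelled 2 5 7; labelled 3 4 7; labelled 3 5 6].

Definition pos : finType := 'I_3.
Definition pa : pos := @Ordinal 3 0 isT.
Definition pb : pos := @Ordinal 3 1 isT.
Definition pc : pos := @Ordinal 3 2 isT.

(* Exactly three lines pass through a point, so injectivity makes the three
   pairs a listing of all of them. *)
Definition is_pencil (u : point * {ffun pos -> {set point}}) : bool :=
  injectiveb u.2 &&
  [forall i, (u.1 \notin u.2 i) && (u.1 |: u.2 i \in fano_lines)].

Record pencil := Pencil {
  pencil_val : point * {ffun pos -> {set point}};
  _ : is_pencil pencil_val }.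

HB.instance Definition _ := [isSub for pencil_val].
HB.instance Definition _ := [Finite of pencil by <:].

Definition base (v : pencil) : point := (pencil_val v).1.
Definition pair_at (v : pencil) (i : pos) : {set point} := (pencil_val v).2 i.

Definition pencil_edge : rel pencil := [rel v w |
  (base v != base w) &&
  [forall i : pos, #|pair_at v i :&: pair_at w i| == 1]].

Lemma pencil_edge_sym : symmetric pencil_edge.
Proof.
move=> v w; rewrite /pencil_edge /= eq_sym; congr (_ && _).
by apply: eq_forallb => i; rewrite setIC.
Qed.

Lemma pencil_edge_irrefl : irreflexive pencil_edge.
Proof. by move=> v; rewrite /pencil_edge /= eqxx. Qed.

Definition G : sgraph := SGraph pencil_edge_sym pencil_edge_irrefl.

(* <xyz>; meaningful only when {x, y, z} is a Fano line. *)
Definition angle (x y z : point) : {set G} :=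
  [set v : pencil | [&& base v \notin [set x; y; z],
     x \in pair_at v pa, y \in pair_at v pb & z \in pair_at v pc]].

(* [xyz]_j; meaningful only when {x, y, z} is a Fano line. *)
Definition bracket (x y z : point) (j : pos) : {set G} :=
  [set v : pencil | (base v \in [set x; y; z]) &&
     (base v |: pair_at v j == [set x; y; z])].

(* Main.v *)
Require Import Defs.
From mathcomp Require Import all_boot all_fingroup.

(** Two pencils with distinct base points are adjacent exactly when they have
    a line in common at some position.  So a vertex of [G] can be encoded by
    its base point and the numbers of its three lines, which turns [G] into an
    explicit graph on 42 codes; there the embeddings of [K4] and [K222] through
    a given vertex are found by exhaustive backtracking. *)

Set Implicit Arguments.
Unset Strict Implicit.
Unset Printing Implicit Defensive.

(** * The graph of codes *)

Definition code := (nat * seq nat)%type.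

(** The order is that of [fano_lines], so the number of a line is also its index there. *)
Definition nat_lines : seq (seq nat) :=
  [:: [:: 0; 1; 2]; [:: 0; 3; 4]; [:: 0; 5; 6]; [:: 1; 3; 5];
      [:: 1; 4; 6]; [:: 2; 3; 6]; [:: 2; 4; 5]].

Definition nat_line (l : nat) : seq nat := nth [::] nat_lines l.

Definition lines_on (p : nat) : seq nat :=
  [seq l <- iota 0 7 | p \in nat_line l].

Definition codes : seq code :=
  [seq (p, s) | p <- iota 0 7, s <- permutations (lines_on p)].

(** The default [7] numbers no line and yields the empty list. *)
Definition code_line (c : code) (i : nat) : seq nat := nat_line (nth 7 c.2 i).

Definition in_pair (c : code) (i x : nat) : bool :=
  (x \in code_line c i) && (x != c.1).

Definition code_edge : rel code := [rel c d |
  (c.1 != d.1) && has (fun k => k.1 == k.2) (zip c.2 d.2)].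

Definition same_points (s t : seq nat) : bool :=
  all (fun x => (x \in s) == (x \in t)) (iota 0 7).

Definition code_angle (x y z : nat) : pred code := fun c =>
  [&& c.1 \notin [:: x; y; z], in_pair c 0 x, in_pair c 1 y & in_pair c 2 z].

Definition code_bracket (x y z i : nat) : pred code := fun c =>
  (c.1 \in [:: x; y; z]) && same_points (code_line c i) [:: x; y; z].

(* The embeddings sending 0 to c of the graph e on {0, ..., n} as an induced
   subgraph of the graph of codes, each given by its list of values. *)
Fixpoint embeddings (e : rel nat) (c : code) (n : nat) : seq (seq code) :=
  if n is n'.+1 then
    [seq rcons t d | t <- embeddings e c n',
       d <- [seq d <- codes | all (fun i => (nth c t i != d) &&
                   (code_edge (nth c t i) d == e i n)) (iota 0 n)]]
  else [:: [:: c]].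

Definition covers_embeddings (e : rel nat) n c (Ps : seq (pred code)) : bool :=
  all (fun t => has (fun P => all P t) Ps) (embeddings e c n).

(** The order of [codes] matters here: it goes by base point, so the two members of a bracket with
    the same base point are consecutive and form one part of [K222_rel]. *)
Definition spans (e : rel nat) n c (P : pred code) : bool :=
  let t := [seq d <- codes | P d] in
  [&& P c, size t == n.+1 &
      all (fun i => all (fun j =>
             code_edge (nth c t i) (nth c t j) == e i j) (iota 0 n.+1))
          (iota 0 n.+1)].

Definition third (x y : nat) : nat :=
  let l := find (fun s => (x \in s) && (y \in s)) nat_lines in
  head 7 [seq z <- nat_line l | (z != x) && (z != y)].

(* The names of the points: qa and qb are chosen freely, and qc has to be the
   third point of the line through them. *)
Definition naming (c : code) : nat * nat * nat * nat * nat * nat :=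
  let q i := head 7 [seq x <- iota 0 7 | in_pair c i x] in
  let qc := third (q 0) (q 1) in
  (q 0, third c.1 (q 0), q 1, third c.1 (q 1), qc, third c.1 qc).

Definition K4_preds (c : code) : seq (pred code) :=
  let: (qa, ra, qb, rb, qc, rc) := naming c in
  [:: code_angle qa qb qc; code_angle qa rb rc;
      code_angle ra qb rc; code_angle ra rb qc].

Definition K222_preds (c : code) : seq (pred code) :=
  let: (qa, ra, qb, rb, qc, rc) := naming c in
  [:: code_bracket c.1 qa ra 0; code_bracket c.1 qb rb 1;
      code_bracket c.1 qc rc 2].

Definition K4_rel : rel nat := [rel i j | i != j].
(** The parts are [{0, 1}], [{2, 3}] and [{4, 5}]. *)
Definition K222_rel : rel nat := [rel i j | i./2 != j./2].

Definition is_line (s : seq nat) : bool := has (same_points s) nat_lines.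

Definition good_naming (c : code) : bool :=
  let: (qa, ra, qb, rb, qc, rc) := naming c in
  let is_pair i q r :=
    all (fun x => in_pair c i x == (x \in [:: q; r])) (iota 0 7) in
  [&& all (gtn 7) [:: qa; ra; qb; rb; qc; rc],
      [&& is_pair 0 qa ra, is_pair 1 qb rb & is_pair 2 qc rc],
      all is_line [:: [:: qa; qb; qc]; [:: qa; rb; rc];
                      [:: ra; qb; rc]; [:: ra; rb; qc]]
    & all is_line [:: [:: c.1; qa; ra]; [:: c.1; qb; rb]; [:: c.1; qc; rc]]].

(** A computable form of [is_pencil], with the bounds needed to rebuild a pencil from its code. *)
Definition well_formed (c : code) : bool :=
  [&& c.1 < 7, size c.2 == 3,
      all (fun i => (nth 7 c.2 i < 7) && (c.1 \in code_line c i)) (iota 0 3)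
    & all (fun i => all (fun j =>
        all (fun x => in_pair c i x == in_pair c j x) (iota 0 7) ==> (i == j))
        (iota 0 3)) (iota 0 3)].

(** Turns a claim about every code into a closed boolean, which [vm_compute] can evaluate. *)
Lemma all_codes (P : pred code) : all P codes -> forall c, c \in codes -> P c.
Proof. by move/allP. Qed.

Lemma codes_well_formed : forall c, c \in codes -> well_formed c.
Proof. by apply: all_codes; vm_compute. Qed.

(** The four lines missing the base point meet each pair in one point, and any two of them share
    exactly one point. Hence, once one of them is called [qa qb qc], each of the others contains one
    [q] and two [r]. *)
Lemma codes_good_naming : forall c, c \in codes -> good_naming c.
Proof. by apply: all_codes; vm_compute. Qed.

Lemma uniq_codes : uniq codes.
Proof. by vm_compute. Qed.

(** Let the base points [p] and [p'] differ. If the line [pp'] has the same position in both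
    pencils, the pairs there share its third point, and at the other positions two distinct lines
    meet outside [p] and [p']. Otherwise, where the first pencil has [pp'], the second has another
    line through [p']; these meet only in [p'], so the pairs are disjoint. *)
Lemma code_edge_pairs c d : c \in codes -> d \in codes ->
  code_edge c d = (c.1 != d.1) &&
    all (fun i => count (fun x => in_pair c i x && in_pair d i x) (iota 0 7)
                  == 1) (iota 0 3).
Proof.
move=> cC dC; apply/eqP; move: c cC d dC.
pose Q c d := code_edge c d == (c.1 != d.1) &&
    all (fun i => count (fun x => in_pair c i x && in_pair d i x) (iota 0 7)
                  == 1) (iota 0 3).
suff QP c : c \in codes -> all (Q c) codes by move=> c /QP/allP.
by move: c; apply: all_codes; vm_compute.
Qed.

Lemma K4_covers : forall c, c \in codes ->
  covers_embeddings K4_rel 3 c (K4_preds c).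
Proof. by apply: all_codes; vm_compute. Qed.

Lemma K222_covers : forall c, c \in codes ->
  covers_embeddings K222_rel 5 c (K222_preds c).
Proof. by apply: all_codes; vm_compute. Qed.

Lemma K4_spans : forall c, c \in codes -> all (spans K4_rel 3 c) (K4_preds c).
Proof. by apply: all_codes; vm_compute. Qed.

Lemma K222_spans : forall c, c \in codes ->
  all (spans K222_rel 5 c) (K222_preds c).
Proof. by apply: all_codes; vm_compute. Qed.

(** Predicates have no decidable equality, so they are compared through the lists of codes that they
    select. *)
Lemma K4_preds_uniq : forall c, c \in codes ->
  uniq [seq [seq d <- codes | P d] | P : pred code <- K4_preds c].
Proof. by apply: all_codes; vm_compute. Qed.

Lemma K222_preds_uniq : forall c, c \in codes ->
  uniq [seq [seq d <- codes | P d] | P : pred code <- K222_preds c].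
Proof. by apply: all_codes; vm_compute. Qed.

(** * Codes of pencils *)

Definition point_set (s : seq nat) : {set point} :=
  [set x : point | nat_of_ord x \in s].

Definition pt (x : nat) : point := inord x.

Lemma ptK x : x < 7 -> nat_of_ord (pt x) = x.
Proof. by move=> x7; rewrite inordK. Qed.

Lemma all_points (P : pred nat) :
  reflect (forall x : point, P x) (all P (iota 0 7)).
Proof.
apply: (iffP allP) => [PP x|PP x].
  by apply: PP; rewrite mem_iota ltn_ord.
by rewrite mem_iota => /ptK <-.
Qed.

Lemma all_positions (P : pred nat) :
  reflect (forall i : pos, P i) (all P (iota 0 3)).
Proof.
apply: (iffP allP) => [PP i|PP i].
  by apply: PP; rewrite mem_iota ltn_ord.
by rewrite mem_iota => /= i3; apply: (PP (Ordinal i3)).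
Qed.

(** True by conversion, since [x.+1 == j.+1] reduces to [x == j]. *)
Lemma fano_linesE : fano_lines = [seq point_set s | s <- nat_lines].
Proof. by []. Qed.

Lemma point_set_eq s t : (point_set s == point_set t) = same_points s t.
Proof.
apply/eqP/all_points => [/setP st x|st]; first by have := st x; rewrite !inE => ->.
by apply/setP => x; rewrite !inE (eqP (st x)).
Qed.

Lemma point_set2 x y : x < 7 -> y < 7 ->
  [set pt x; pt y] = point_set [:: x; y].
Proof.
move=> x7 y7; apply/setP => u.
by rewrite !inE -!val_eqE /= !ptK.
Qed.

Lemma point_set3 x y z : x < 7 -> y < 7 -> z < 7 ->
  [set pt x; pt y; pt z] = point_set [:: x; y; z].
Proof.
move=> x7 y7 z7; apply/setP => u.
by rewrite !inE -!val_eqE /= !ptK // orbA.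
Qed.

Lemma is_line_fano s : is_line s -> point_set s \in fano_lines.
Proof.
case/hasP => t tL; rewrite -point_set_eq => /eqP ->.
by rewrite fano_linesE map_f.
Qed.

Lemma uniq_fano_lines : uniq fano_lines.
Proof.
rewrite fano_linesE map_inj_in_uniq // => s t sL tL /eqP.
rewrite point_set_eq => st.
(* Equality of sets has become [same_points], which is decided by computation on lists of
   numbers. *)
pose Q s := all (fun t => same_points s t ==> (s == t)) nat_lines.
have: all Q nat_lines by vm_compute.
by move/allP/(_ s sL)/allP/(_ t tL)/implyP/(_ st)/eqP.
Qed.

Lemma card_points (P : pred nat) :
  #|[set x : point | P x]| = count P (iota 0 7).
Proof.
rewrite -sum1_card -sum1_count -[iota 0 7]/(index_iota 0 7) big_mkord.
by apply: eq_bigl => x; rewrite inE.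
Qed.

(** * The bijection between pencils and codes *)

Definition line_at (v : pencil) (i : pos) : {set point} :=
  base v |: pair_at v i.

Definition line_number (v : pencil) (i : pos) : nat :=
  index (line_at v i) fano_lines.

Definition code_of (v : pencil) : code :=
  (nat_of_ord (base v), [seq line_number v i | i <- enum 'I_3]).

Lemma pair_at_inj v : injective (pair_at v).
Proof. by have /andP[/injectiveP] := valP v. Qed.

Lemma base_notin v i : base v \notin pair_at v i.
Proof. by have /andP[_ /forallP/(_ i)/andP[]] := valP v. Qed.

Lemma line_at_fano v i : line_at v i \in fano_lines.
Proof. by have /andP[_ /forallP/(_ i)/andP[]] := valP v. Qed.

Lemma line_number_lt v i : line_number v i < 7.
Proof. by rewrite -[7]/(size fano_lines) index_mem line_at_fano. Qed.

Lemma nth_code_of v (i : pos) : nth 7 (code_of v).2 i = line_number v i.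
Proof.
rewrite (nth_map i); last by rewrite size_enum_ord ltn_ord.
by rewrite (nth_ord_enum i i).
Qed.

Lemma line_atE v (i : pos) : line_at v i = point_set (code_line (code_of v) i).
Proof.
rewrite /code_line nth_code_of -(nth_map _ set0) ?line_number_lt //.
by rewrite -fano_linesE nth_index // line_at_fano.
Qed.

Lemma mem_pair_at v (i : pos) (x : point) :
  (x \in pair_at v i) = in_pair (code_of v) i x.
Proof.
have := congr1 (fun A : {set point} => x \in A) (line_atE v i).
rewrite /= !inE /in_pair => <- /=; rewrite val_eqE.
by case: eqVneq => [->|] /=; rewrite ?andbT // (negbTE (base_notin v i)).
Qed.

(** A pair is its line without the base point, so equal lines give equal pairs. *)
Lemma line_number_inj v : injective (line_number v).
Proof.
move=> i j ij; apply: (@pair_at_inj v); apply/setP => x.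
by rewrite !mem_pair_at /in_pair /code_line !nth_code_of ij.
Qed.

(** The three line numbers are distinct and lie in [lines_on (base v)], which has at most three
    entries; so they are a permutation of it. *)
Lemma code_of_codes v : code_of v \in codes.
Proof.
apply/allpairsPdep; exists (nat_of_ord (base v)), (code_of v).2; split=> //.
  by rewrite mem_iota ltn_ord.
have Us : uniq (code_of v).2.
  by rewrite (map_inj_uniq (@line_number_inj v)) enum_uniq.
have sub : {subset (code_of v).2 <= lines_on (base v)}.
  move=> _ /mapP[i _ ->]; rewrite mem_filter mem_iota line_number_lt andbT.
  have := setU11 (base v) (pair_at v i).
  by rewrite -/(line_at v i) line_atE inE /code_line nth_code_of => ->.
have sz : size (lines_on (base v)) <= size (code_of v).2.
  rewrite size_map size_enum_ord.
  pose Q p := size (lines_on p) <= 3.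
  have /all_points QP : all Q (iota 0 7) by vm_compute.
  exact: QP.
rewrite mem_permutations uniq_perm ?filter_uniq ?iota_uniq //.
by have [] := uniq_min_size Us sub sz.
Qed.

Lemma code_of_inj : injective code_of.
Proof.
move=> v w vw; apply: val_inj; rewrite /= [LHS]surjective_pairing.
rewrite [RHS]surjective_pairing; congr pair.
  exact: ord_inj (congr1 fst vw).
by apply/ffunP => i; apply/setP => x; have := mem_pair_at w i x; rewrite -vw -mem_pair_at.
Qed.

Lemma code_of_surj c : c \in codes -> exists v, code_of v = c.
Proof.
case/codes_well_formed/and4P => p7 /eqP s3 /all_positions lP /all_positions iP.
(* The pairs are recovered by removing the base point from each line. *)
pose f := [ffun i : pos => [set x : point | in_pair c i x]].
have lineE (i : pos) : pt c.1 |: f i = point_set (code_line c i).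
  apply/setP => x; rewrite !inE ffunE inE /in_pair -val_eqE /= ptK //.
  by case: eqVneq => [->|]; rewrite ?andbT //; case/andP: (lP i).
have fP : is_pencil (pt c.1, f).
  apply/andP; split=> /=.
    apply/injectiveP => i j /setP fij; apply/eqP.
    have /all_positions/(_ j)/implyP := iP i; apply; apply/all_points => x.
    by have := fij x; rewrite !ffunE !inE => ->.
  apply/forallP => i; rewrite lineE ffunE inE /in_pair ptK // eqxx andbF /=.
  by rewrite fano_linesE map_f // mem_nth //; case/andP: (lP i).
exists (Pencil fP); rewrite [RHS]surjective_pairing; congr pair; first exact: ptK.
apply: (@eq_from_nth _ 7) => [|k]; rewrite size_map size_enum_ord ?s3 // => k3.
rewrite (nth_code_of (Pencil fP) (Ordinal k3)) /line_number /line_at.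
rewrite [_ |: _]lineE /code_line -(nth_map _ set0); last by case/andP: (lP (Ordinal k3)).
by rewrite index_uniq ?uniq_fano_lines //; case/andP: (lP (Ordinal k3)).
Qed.

Lemma edge_code_of (v w : G) : edge v w = code_edge (code_of v) (code_of w).
Proof.
rewrite code_edge_pairs ?code_of_codes //; congr (_ && _).
apply/forallP/all_positions => vw i; have := vw i; rewrite -card_points;
  congr (#|pred_of_set _| == 1); apply/setP => x; rewrite !inE !mem_pair_at //.
Qed.

(** * Vertex sets described by predicates on codes *)

Definition code_set (P : pred code) : {set G} := [set v : pencil | P (code_of v)].

Lemma card_code_set P : #|code_set P| = size [seq c <- codes | P c].
Proof.
rewrite cardE -(size_map code_of); apply/perm_size/uniq_perm.
- by rewrite (map_inj_uniq code_of_inj) enum_uniq.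
- by rewrite filter_uniq // uniq_codes.
move=> c; rewrite mem_filter; apply/mapP/andP => [[v]|[Pc /code_of_surj[v vc]]].
  by rewrite mem_enum inE => Pv ->; rewrite code_of_codes.
by exists v; rewrite // mem_enum inE vc.
Qed.

Lemma uniq_code_sets (Ps : seq (pred code)) :
  uniq [seq [seq c <- codes | P c] | P : pred code <- Ps] ->
  uniq [seq code_set P | P <- Ps].
Proof.
(* [g] maps [code_set P] to the list of codes satisfying [P], so distinct lists come from distinct
   sets. *)
pose g (A : {set G}) := [seq c <- codes | c \in [seq code_of v | v in A]].
move=> uPs; apply: (@map_uniq _ _ g); rewrite -map_comp.
congr (uniq _ = true): uPs; apply: eq_map => P.
apply: eq_in_filter => c /code_of_surj[v <-].
by rewrite (mem_image code_of_inj) inE.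
Qed.

Lemma angle_code x y z : x < 7 -> y < 7 -> z < 7 ->
  angle (pt x) (pt y) (pt z) = code_set (code_angle x y z).
Proof.
move=> x7 y7 z7; apply/setP => v; rewrite !inE !mem_pair_at /= !ptK //.
by rewrite -!val_eqE /= !ptK // /code_angle !inE orbA.
Qed.

Lemma bracket_code x y z (i : pos) : x < 7 -> y < 7 -> z < 7 ->
  bracket (pt x) (pt y) (pt z) i = code_set (code_bracket x y z i).
Proof.
move=> x7 y7 z7; apply/setP => v; rewrite !inE -/(line_at v i) line_atE.
by rewrite point_set3 // point_set_eq -!val_eqE /= !ptK // /code_bracket !inE orbA.
Qed.

(** * Copies of a graph *)

(** Replaces isomorphisms onto induced subgraphs by embeddings into the whole graph, the objects
    that the search enumerates. *)
Lemma is_copyP (H F : sgraph) (S : {set F}) :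
  is_copy H S <-> exists h : H -> F,
    [/\ injective h, forall x y, edge (h x) (h y) = edge x y
      & S = [set h x | x : H]].
Proof.
split=> [[f [[g fK gK] fE]]|[h [h_inj hE SE]]].
  exists (fun x => val (g x)); split=> [x y|x y|].
  - by move/val_inj/(can_inj gK).
  - by rewrite -[x in RHS]gK -[y in RHS]gK fE.
  apply/setP => u; apply/idP/imsetP => [uS|[x _ ->]]; last exact: valP.
  by exists (f (exist _ u uS)); rewrite ?fK.
have hS x : h x \in S by rewrite SE imset_f.
pose h' x : {u : F | u \in S} := exist _ (h x) (hS x).
have h'_inj : injective h' by move=> x y [] /h_inj.
have [|g h'K gK] := inj_card_bij h'_inj.
  by rewrite card_sig -(card_imset _ h_inj) -SE; apply: subset_leq_card; apply/subsetP.
exists g; split; first by exists h'.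
by move=> a b; rewrite -hE -[a in RHS]gK -[b in RHS]gK.
Qed.

(** By finiteness, an injective [s] that preserves and reflects edges is an automorphism. *)
Definition vertex_transitive (H : sgraph) : Prop :=
  forall x y : H, exists s : H -> H,
    [/\ injective s, forall a b, edge (s a) (s b) = edge a b & s x = y].

Definition numbering (H : sgraph) n (e : rel nat) (k : 'I_n.+1 -> H) : Prop :=
  bijective k /\ forall i j : 'I_n.+1, edge (k i) (k j) = e i j.

Lemma numbering_copy (H F : sgraph) n (e : rel nat) (k : 'I_n.+1 -> H)
    (h : 'I_n.+1 -> F) :
  numbering e k -> injective h ->
  (forall i j : 'I_n.+1, edge (h i) (h j) = e i j) ->
  is_copy H [set h i | i : 'I_n.+1].
Proof.
move=> [[k' kK k'K] kE] h_inj hE; apply/is_copyP; exists (fun x => h (k' x)).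
split=> [x y /h_inj/(can_inj k'K)//|x y|]; first by rewrite hE -kE !k'K.
apply/setP => u; apply/imsetP/imsetP => -[x _ ->]; last by exists (k' x).
by exists (k x); rewrite ?kK.
Qed.

(** Composing an embedding with an automorphism that moves vertex [0] to the preimage of [v] makes
    it start at [v]; the image is unchanged. So the search may fix its first value. *)
Lemma copy_through (H F : sgraph) n (e : rel nat) (k : 'I_n.+1 -> H)
    (S : {set F}) (v : F) :
  vertex_transitive H -> numbering e k ->
  is_copy H S -> v \in S -> exists h : 'I_n.+1 -> F,
    [/\ injective h, forall i j : 'I_n.+1, edge (h i) (h j) = e i j, h ord0 = v
      & S = [set h i | i : 'I_n.+1]].
Proof.
move=> trH [[k' kK k'K] kE] /is_copyP[h [h_inj hE SE]].
rewrite SE => /imsetP[x _ ->].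
have [s [s_inj sE s0]] := trH (k ord0) x.
have hsk_inj : injective (fun i => h (s (k i))).
  by move=> i j /h_inj/s_inj/(can_inj kK).
exists (fun i => h (s (k i))); split=> // [i j||].
- by rewrite hE sE kE.
- by rewrite s0.
apply/esym/eqP; rewrite eqEcard; apply/andP; split.
  by apply/subsetP => _ /imsetP[i _ ->]; rewrite imset_f.
by rewrite !card_imset // (bij_eq_card (Bijective kK k'K)).
Qed.

Lemma embeddings_complete n (e : rel nat) (h : 'I_n.+1 -> G) :
  injective h -> (forall i j : 'I_n.+1, edge (h i) (h j) = e i j) ->
  mkseq (fun i => code_of (h (inord i))) n.+1
    \in embeddings e (code_of (h ord0)) n.
Proof.
move=> h_inj hE; set c := code_of _; set g := fun i => _.
(* Induction on the stage of the search: the first [m.+1] values of [h] pass the tests made up to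
   stage [m]. *)
suff: forall m, m <= n -> mkseq g m.+1 \in embeddings e c m by apply.
elim=> [_|m IH mn].
  by rewrite inE /mkseq /= /g /c (_ : inord 0 = ord0) //; apply/val_inj; rewrite /= inordK.
rewrite mkseqS; apply/allpairsPdep; exists (mkseq g m.+1), (g m.+1).
split=> //; first exact: IH (ltnW mn).
rewrite mem_filter code_of_codes andbT; apply/allP => i.
rewrite mem_iota add0n => /= im; rewrite nth_mkseq // /g -edge_code_of hE.
have i_n : i < n.+1 by apply: ltn_trans im _.
rewrite !inordK // eqxx andbT (inj_eq code_of_inj) (inj_eq h_inj) -val_eqE /=.
by rewrite !inordK // neq_ltn im.
Qed.

Lemma spans_embedding n (e : rel nat) (v : G) (P : pred code) :
  spans e n (code_of v) P ->
  exists h : 'I_n.+1 -> G,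
    [/\ injective h, forall i j : 'I_n.+1, edge (h i) (h j) = e i j
      & code_set P = [set h i | i : 'I_n.+1]].
Proof.
case/and3P; set t := [seq _ <- _ | _] => _ /eqP tn /allP tE.
(* Choice of a pencil for each code selected by [P]. *)
have nthP (i : 'I_n.+1) : {w : pencil | code_of w == nth (code_of v) t i}.
  apply: sigW; have /code_of_surj[w wE] : nth (code_of v) t i \in codes.
    have: nth (code_of v) t i \in t by rewrite mem_nth ?tn.
    by rewrite mem_filter => /andP[].
  by exists w; rewrite wE.
pose h i := sval (nthP i).
have hE i : code_of (h i) = nth (code_of v) t i by rewrite (eqP (svalP (nthP i))).
have h_inj : injective h.
  move=> i j /(congr1 code_of)/eqP; rewrite !hE nth_uniq ?tn //.
    by move/eqP/val_inj.
  by rewrite filter_uniq // uniq_codes.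
exists h; split=> // [i j|].
  have in_iota (k : 'I_n.+1) : (k : nat) \in iota 0 n.+1 by rewrite mem_iota ltn_ord.
  have /allP/(_ j (in_iota j))/eqP := tE i (in_iota i).
  by rewrite edge_code_of !hE.
apply/esym/eqP; rewrite eqEcard card_imset // card_ord card_code_set tn leqnn andbT.
apply/subsetP => _ /imsetP[i _ ->]; rewrite inE hE.
have: nth (code_of v) t i \in t by rewrite mem_nth ?tn.
by rewrite mem_filter => /andP[].
Qed.

(** A copy through [v] is the image of an embedding found by the search, hence contained in some
    [code_set P]. Both have [n.+1] elements, so they coincide. Conversely, [spans] makes each
    [code_set P] a copy through [v]. *)
Lemma copies_code_sets (H : sgraph) n (e : rel nat) (k : 'I_n.+1 -> H) (v : G)
    (Ps : seq (pred code)) :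
  vertex_transitive H -> numbering e k ->
  covers_embeddings e n (code_of v) Ps -> all (spans e n (code_of v)) Ps ->
  forall S : {set G},
    is_copy H S /\ v \in S <-> S \in [seq code_set P | P <- Ps].
Proof.
move=> trH kP cov sp S; split.
  case=> copyS vS; have [h [h_inj hE h0 ->]] := copy_through trH kP copyS vS.
  have := embeddings_complete h_inj hE; rewrite h0 => /(allP cov); set t := mkseq _ _.
  have : forall i, code_of (h i) \in t.
    move=> i; apply/mapP; exists (i : nat); last by rewrite inord_val.
    by rewrite mem_iota ltn_ord.
  move: (t) => {}t tP.
  elim: Ps sp {cov} => //= P Ps IH /andP[spP spPs] /orP[hP|/(IH spPs) SP]; last first.
    by rewrite inE SP orbT.
  rewrite inE eqEcard card_imset // card_ord card_code_set.
  case/and3P: spP => _ /eqP -> _; rewrite leqnn andbT.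
  apply/orP; left; apply/subsetP => _ /imsetP[i _ ->]; rewrite inE.
  exact: (allP hP).
elim: Ps sp {cov} => //= P Ps IH /andP[spP spPs]; rewrite inE.
case/orP => [/eqP ->|]; last exact: IH.
have [h [h_inj hE SE]] := spans_embedding spP; split; last first.
  by rewrite inE; case/and3P: spP.
by rewrite SE; apply: numbering_copy kP h_inj hE.
Qed.

(** * The graphs [K4] and [K222] *)

Lemma K4_vertex_transitive : vertex_transitive K4.
Proof.
move=> x y; exists (tperm x y); split=> [||]; [exact: perm_inj | | exact: tpermL].
by move=> a b; rewrite /= /K4_edge /= (inj_eq perm_inj).
Qed.

(** One transposition acts on the parts, another on the places within every part; adjacency depends
    on the parts alone. *)
Lemma K222_vertex_transitive : vertex_transitive K222.
Proof.
move=> x y; exists (fun u => (tperm x.1 y.1 u.1, tperm x.2 y.2 u.2)); split.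
- by move=> [a b] [c d] /= [/perm_inj -> /perm_inj ->].
- by move=> a b; rewrite /= /K222_edge /= (inj_eq perm_inj).
by rewrite !tpermL -surjective_pairing.
Qed.

Lemma K4_numbering : @numbering K4 3 K4_rel id.
Proof. by split=> //; exists id. Qed.

Lemma K222_numbering :
  @numbering K222 5 K222_rel (fun i => (inord i./2, inord (odd i))).
Proof.
have half_lt (i : 'I_6) : i./2 < 3 by rewrite ltn_half_double.
split=> [|i j]; last by rewrite /= /K222_edge /= -val_eqE /= !inordK.
apply: inj_card_bij; last by rewrite card_prod !card_ord.
move=> i j [/(congr1 val) /= + /(congr1 val) /=]; rewrite !inordK ?half_lt ?ltnS ?leq_b1 //.
by move=> hij oij; apply: val_inj; rewrite /= -[LHS]odd_double_half hij oij odd_double_half.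
Qed.

Theorem theorem4p2 (v : G) :
  exists qa ra qb rb qc rc : point,
    let p := base v in
    let K4s := [:: angle qa qb qc; angle qa rb rc;
                   angle ra qb rc; angle ra rb qc] in
    let K222s := [:: bracket p qa ra pa; bracket p qb rb pb;
                     bracket p qc rc pc] in
    [/\ pair_at v pa = [set qa; ra],
        pair_at v pb = [set qb; rb]
      & pair_at v pc = [set qc; rc]] /\
    [/\ [set qa; qb; qc] \in fano_lines,
        [set qa; rb; rc] \in fano_lines,
        [set ra; qb; rc] \in fano_lines
      & [set ra; rb; qc] \in fano_lines] /\
    [/\ [set p; qa; ra] \in fano_lines,
        [set p; qb; rb] \in fano_lines
      & [set p; qc; rc] \in fano_lines] /\
    (uniq K4s /\
     forall S : {set G}, (is_copy K4 S /\ v \in S) <-> S \in K4s) /\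
    (uniq K222s /\
     forall S : {set G}, (is_copy K222 S /\ v \in S) <-> S \in K222s).
Proof.
have vC := code_of_codes v.
have K4v := copies_code_sets K4_vertex_transitive K4_numbering
              (K4_covers vC) (K4_spans vC).
have K222v := copies_code_sets K222_vertex_transitive K222_numbering
              (K222_covers vC) (K222_spans vC).
have K4u := uniq_code_sets (K4_preds_uniq vC).
have K222u := uniq_code_sets (K222_preds_uniq vC).
(* All these facts mention the same tuple [naming (code_of v)]; in the goal they are destructed
   together. *)
move: (codes_good_naming vC) K4v K222v K4u K222u.
rewrite /good_naming /K4_preds /K222_preds.
case: (naming _) => [[[[[qa ra] qb] rb] qc] rc].
case/and4P => lt7 /and3P[prA prB prC].
case/and5P => l1 l2 l3 l4 _ /and4P[m1 m2 m3 _] K4v K222v K4u K222u.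
case/and5P: lt7 => qa7 ra7 qb7 rb7 /and3P[qc7 rc7 _].
have p7 : (code_of v).1 < 7 by apply: ltn_ord.
have pE : base v = pt (code_of v).1 by apply: ord_inj; rewrite (ptK p7).
have pairE (i : pos) x y : x < 7 -> y < 7 ->
    all (fun u => in_pair (code_of v) i u == (u \in [:: x; y])) (iota 0 7) ->
    pair_at v i = [set pt x; pt y].
  move=> x7 y7 /all_points xy; rewrite point_set2 //; apply/setP => u.
  by rewrite mem_pair_at inE (eqP (xy u)).
exists (pt qa), (pt ra), (pt qb), (pt rb), (pt qc), (pt rc).
(* Every angle and bracket becomes the [code_set] of its predicate, the form in which the copies are
   known. *)
rewrite pE !bracket_code // !angle_code // !point_set3 //.
split; first by split; apply: pairE.
split; first by split; apply: is_line_fano.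
split; first by split; apply: is_line_fano.
by split; split.
Qed.
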